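(* Let $X$ be a $\{0,1\}$-valued process on a finite connected graph $G$ that satisfies the Markov property, and assume that for all finite $A\subseteq V(G)$ we have $$P\bigl(X(A)\equiv0\mid X(\mathcal{B}^+(A))\equiv0\bigr)>0.$$ Let $\nu$ be the unique signed measure on $\mathcal{P}(V(G))\setminus\{\emptyset\}$ that satisfies $\nu(\mathcal{S}_I^\cup)=-\log P(X(I)\equiv0)$ for all $I\subseteq V(G)$, and let $D$ be any disconnected subset of $V(G)$. Then $\nu(D)=0$.
   Context: $V(G)$ is the vertex set of $G$; $v\sim v'$ means $v,v'$ are neighbors. $X(A)\equiv0$ means $X(v)=0$ for all $v\in A$. For $A\subseteq V(G)$, the outer boundary is $\mathcal{B}^+(A)=\{v\in V(G)\setminus A:\exists v'\in A,\ v\sim v'\}$. The Markov property: for every $A\subseteq V(G)$, conditionally on $X(\mathcal{B}^+(A))$, $X(A)$ is independent of $X(V(G)\setminus(A\cup\mathcal{B}^+(A)))$. A set of vertices is connected if it induces a connected subgraph, and disconnected otherwise. For a finite set $S$ and $I\subseteq S$, $\mathcal{S}_I^\cup=\{B\in\mathcal{P}(S)\setminus\{\emptyset\}:B\cap I\neq\emptyset\}$ (here $S=V(G)$). It is known that if $P(X(I)\equiv0)>0$ for all nonempty $I\subseteq S$, then there is a unique signed measure $\nu$ on $\mathcal{P}(S)\setminus\{\emptyset\}$ with $\nu(\mathcal{S}_I^\cup)=-\log P(X(I)\equiv0)$ for all $I\subseteq S$; it is given by $\nu(K)=\sum_{I\subseteq K}(-1)^{|K|-|I|}\log P(X(S\setminus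 I)\equiv0)$ for $\emptyset\ne K\subseteq S$. *)

(* Defs.v *)
From HB Require Import structures.
From mathcomp Require Import all_boot all_order all_algebra.
From mathcomp Require Import all_classical all_reals all_analysis.

Set Implicit Arguments.
Unset Strict Implicit.
Unset Printing Implicit Defensive.

Import Order.TTheory GRing.Theory Num.Theory.
Import numFieldNormedType.Exports.

Local Open Scope classical_set_scope.
Local Open Scope ring_scope.

Section Graph.
Variables (V : finType) (e : rel V).

Definition outer_boundary (A : {set V}) : {set V} :=
  [set v | (v \notin A) && [exists v' in A, e v v']]%SET.

(* The empty set counts as connected, so a disconnected set is nonempty. *)
Definition connected_set (A : {set V}) : bool :=
  [forall x in A, forall y in A,
    connect [rel u v | [&& u \in A, v \in A & e u v]] x y].

End Graph.

Section Process.
Context d (Omega : measurableType d) (R : realType) (P : probability Omega R).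

(* Equals 0 when [P F = 0], so [0 < cond_prob E F] forces [0 < P F]. *)
Definition cond_prob (E F : set Omega) : R :=
  fine (P (E `&` F)) / fine (P F).

(* Y and Z are independent conditionally on W, for random variables with
   values in finite sets, all of whose subsets are events. *)
Definition cond_indep (TY TZ TW : finType)
    (Y : Omega -> TY) (Z : Omega -> TZ) (W : Omega -> TW) : Prop :=
  forall c : TW, (0 < P (W @^-1` [set c]))%E ->
  forall (E : set TY) (F : set TZ),
    cond_prob (Y @^-1` E `&` Z @^-1` F) (W @^-1` [set c]) =
    cond_prob (Y @^-1` E) (W @^-1` [set c]) *
    cond_prob (Z @^-1` F) (W @^-1` [set c]).

Variables (V : finType) (X : V -> {RV P >-> bool}).

(* X(A), as a random element of {0,1}^A. *)
Definition restr (A : {set V}) (w : Omega) : {ffun {v : V | v \in A} -> bool} :=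
  [ffun v => X (val v) w].

(* The event X(A) == 0; the value 0 is [false]. *)
Definition vanish (A : {set V}) : set Omega :=
  [set w | forall v, v \in A -> X v w = false].

Definition markov_property (e : rel V) : Prop :=
  forall A : {set V},
    cond_indep (restr A) (restr (~: (A :|: outer_boundary e A))%SET)
               (restr (outer_boundary e A)).

End Process.

(* Nonempty subsets of V. The vertex v0 only serves to inhabit the type, as
   every measurableType must be pointed. *)
Definition nesubset (V : finType) (v0 : V) : Type :=
  {K : {set V} | K != finset.set0}.

Section NonemptySubsets.
Variables (V : finType) (v0 : V).

HB.instance Definition _ := Finite.on (nesubset v0).
HB.instance Definition _ := SubType.on (nesubset v0).

Lemma set1_nonempty : [set v0]%SET != finset.set0.
Proof. by apply/set0Pn; exists v0; rewrite finset.in_set1. Qed.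

HB.instance Definition _ := isPointed.Build (nesubset v0)
  (exist (fun K : {set V} => K != finset.set0) [set v0]%SET set1_nonempty).

HB.instance Definition _ := @isMeasurable.Build default_measure_display
  (nesubset v0) discrete_measurable (@discrete_measurable0 _)
  (@discrete_measurableC _) (@discrete_measurableU _).

(* S_I^\cup, with S = V. *)
Definition meeting (I : {set V}) : set (nesubset v0) :=
  [set K | (val K :&: I)%SET != finset.set0].

End NonemptySubsets.

(* Main.v *)
Require Import Defs.
From mathcomp Require Import all_boot all_order all_algebra.
From mathcomp Require Import all_classical all_reals all_analysis.
Import Order.TTheory GRing.Theory Num.Theory.
Import numFieldNormedType.Exports.
Local Open Scope classical_set_scope.
Local Open Scope ring_scope.

(* Let A be a connected component of the graph induced on D, and let I range
   over the subsets of D.  The complement of I contains the boundary of A,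
   because this boundary is disjoint from D; so the Markov property splits
   log P(X(~I) = 0) into a term not depending on I \ A and a term not
   depending on I :&: A.  The alternating sum over I of either term vanishes,
   by toggling a vertex of D \ A or of A, while the alternating sum of
   nu(meeting ~I) is, by Moebius inversion, nu(D) up to sign. *)

(** Pairing I with [b |: I] flips the sign and keeps the value of [F], so the terms cancel in
    pairs. *)
Lemma alternating_sum_toggle (R : pzRingType) (V : finType) (D : {set V})
    (b : V) (F : {set V} -> R) :
  b \in D -> (forall I : {set V}, b \notin I -> F (b |: I)%SET = F I) ->
  \sum_(I : {set V} | I \subset D) (-1) ^+ #|I| * F I = 0.
Proof.
move=> bD Fb; rewrite (bigID (fun I : {set V} => b \in I)) /=.
rewrite (reindex_onto (fun I : {set V} => b |: I)%SET (fun I : {set V} => I :\ b)%SET) /=; last first.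
  by move=> I /andP[_ bI]; rewrite finset.setD1K.
(* The round-trip condition [(b |: I) :\ b = I] of the reindexing holds exactly when b is not in
   I. *)
rewrite (eq_bigl (fun I : {set V} => (I \subset D) && (b \notin I))); last first.
  move=> I; rewrite setU11 andbT finset.subUset finset.sub1set bD /=.
  have [bI|bI] /= := boolP (b \in I); last by rewrite setU1K ?eqxx.
  congr (_ && _); apply/eqP => /setP/(_ b).
  by rewrite finset.in_setD1 eqxx bI.
rewrite -big_split big1 //= => I /andP[_ bI].
by rewrite Fb // cardsU1 bI exprS mulN1r mulNr addNr.
Qed.

Section FiniteCharge.
Context (R : realType) (V : finType) (v0 : V).
Variable nu : {charge set (nesubset v0) -> \bar R}.

Lemma charge_sum_singletons (p : pred (nesubset v0)) :
  nu [set K | p K] = \sum_(K | p K) nu [set K].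
Proof.
have charge_seq (s : seq (nesubset v0)) : uniq s ->
    nu [set K | K \in s] = \sum_(K <- s) nu [set K].
  elim: s => [_|K s IHs] /=.
    rewrite big_nil -[RHS](charge0 nu); congr (nu _).
    by rewrite -subset0 => K.
  case/andP=> Ks us; rewrite big_cons -IHs // -chargeU //.
    by congr (nu _); apply/seteqP; split=> L /=; rewrite inE => /predU1P.
  by rewrite -subset0 => L [-> /=]; exact/negP.
rewrite -big_filter -charge_seq ?filter_uniq ?index_enum_uniq //.
by congr (nu _); apply/seteqP; split=> L /=; rewrite mem_filter mem_index_enum andbT.
Qed.

Lemma charge_fin_num (A : set (nesubset v0)) : nu A \is a fin_num.
Proof. exact: fin_num_measure. Qed.

(** Moebius inversion: K meets the complement of I exactly when K is not contained in I, so each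
    summand involves the total mass minus the masses of the subsets of I. *)
Lemma alternating_sum_meeting (D : nesubset v0) :
  \sum_(I : {set V} | I \subset val D)
    (-1) ^+ #|I| * fine (nu (meeting (~: I)%SET)) =
  - (-1) ^+ #|val D| * fine (nu [set D]).
Proof.
pose n (K : nesubset v0) := fine (nu [set K]).
have meetE (I : {set V}) : fine (nu (meeting (~: I)%SET)) =
    \sum_(K : nesubset v0) n K -
    \sum_(K : nesubset v0) (val K \subset I)%:R * n K.
  rewrite (_ : meeting _ = [set K : nesubset v0 | ~~ (val K \subset I)]); last first.
    by apply/seteqP; split=> K; rewrite /meeting /= finset.setI_eq0 finset.disjoints_subset finset.setCK.
  rewrite charge_sum_singletons -sum_fine; last by move=> K _; exact: charge_fin_num.
  rewrite -sumrB big_mkcond /=; apply: eq_bigr => K _.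
  by case: (_ \subset _); rewrite ?mul1r ?subrr ?mul0r ?subr0.
(* As D is nonempty, some b can be toggled to remove the total mass, which does not depend on I. *)
have /set0Pn[b bD] := valP D.
under eq_bigr do rewrite meetE mulrBr.
rewrite sumrB (alternating_sum_toggle _ _ _ b) // sub0r.
under eq_bigr do rewrite mulr_sumr.
(* After the exchange, K is weighted by the alternating sum over the sets I between K and D. For K =
   D only I = D remains. *)
rewrite exchange_big /= (bigD1 D) //= [X in _ + X]big1 ?addr0 => [|K KD].
  rewrite (bigD1 (val D)) //= subxx mul1r [X in _ + X]big1 ?addr0 ?mulNr //.
  move=> I /andP[ID IneqD]; rewrite (_ : _ \subset _ = false) ?mul0r ?mulr0 //.
  by apply: contraNF IneqD => DI; rewrite finset.eqEsubset ID.
have [KsubD|KnD] := boolP (val K \subset val D); last first.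
  rewrite big1 // => I ID; rewrite (_ : _ \subset _ = false) ?mul0r ?mulr0 //.
  by apply: contraNF KnD => /fintype.subset_trans; apply.
(* K is now a proper subset of D, and toggling a vertex c of D outside K does not affect whether K
   is contained in I. *)
have /subsetPn[c cD cK] : ~~ (val D \subset val K).
  by apply: contra KD => DK; rewrite -val_eqE finset.eqEsubset KsubD.
apply: (alternating_sum_toggle _ _ _ c) => // I cI.
rewrite -finset.subDset (_ : val K :\ c = val K)%SET //.
by apply/finset.setDidPl; rewrite fintype.disjoint_sym disjoints1.
Qed.

End FiniteCharge.

Section Vanish.
Context (R : realType) (V : finType) (e : rel V).
Context (d : measure_display) (Omega : measurableType d).
Context (P : probability Omega R) (X : V -> {RV P >-> bool}).

Lemma vanishU (A B : {set V}) :
  vanish X (A :|: B)%SET = vanish X A `&` vanish X B.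
Proof.
apply/seteqP; split=> w /=.
  by move=> wAB; split=> v vA; apply: wAB; rewrite finset.in_setU vA ?orbT.
by case=> wA wB v; rewrite finset.in_setU => /orP[/wA|/wB].
Qed.

Lemma measurable_vanish (A : {set V}) : measurable (vanish X A).
Proof.
rewrite (_ : vanish X A = \bigcap_(v in [set` A]) (X v @^-1` [set false])).
  apply: fin_bigcap_measurable => // v _.
  by rewrite -[_ @^-1` _]setTI; exact: measurable_funPT.
by apply/seteqP; split=> w wA v /wA.
Qed.

Lemma fin_num_vanish (A : {set V}) : P (vanish X A) \is a fin_num.
Proof. by apply: fin_num_measure; exact: measurable_vanish. Qed.

(** Puts the event into the form that [cond_indep] speaks about, a preimage under the restriction to
    a possibly larger set. *)
Lemma vanish_restr (A B : {set V}) : A \subset B ->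
  vanish X A = restr X B @^-1` [set f | forall v, val v \in A -> f v = false].
Proof.
move=> /fintype.subsetP AB; apply/seteqP; split=> w /= wA v vA.
  by rewrite ffunE; exact: wA.
by have := wA (exist _ v (AB v vA)) vA; rewrite ffunE.
Qed.

Lemma vanish_restr_cst (A : {set V}) :
  vanish X A = restr X A @^-1` [set [ffun=> false]].
Proof.
rewrite (vanish_restr A A) //; apply/seteqP; split=> w /=.
  by move=> wA; apply/ffunP => v; rewrite [RHS]ffunE; exact: (wA v (valP v)).
by move=> -> v _; rewrite ffunE.
Qed.

Definition log_vanish (A : {set V}) : R := ln (fine (P (vanish X A))).

Hypothesis X_markov : markov_property X e.
Hypothesis vanish_setT_gt0 : 0 < fine (P (vanish X [set: V]%SET)).

Lemma vanish_gt0 (A : {set V}) : 0 < fine (P (vanish X A)).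
Proof.
apply: lt_le_trans vanish_setT_gt0 _; apply: fine_le.
- exact: fin_num_vanish.
- exact: fin_num_vanish.
- apply: le_measure; rewrite ?inE; try exact: measurable_vanish.
  by move=> w wT v _; apply: wT; rewrite finset.in_setT.
Qed.

(** Conditional independence given X(B) = 0, cleared of one factor 1 / P(X(B) = 0), is a product
    formula between positive numbers; its logarithm is the claim. *)
Lemma log_vanish_markov (A I J : {set V}) (B := outer_boundary e A) :
  I \subset A -> J \subset (~: (A :|: B))%SET ->
  log_vanish (I :|: J :|: B)%SET =
    log_vanish (I :|: B)%SET + log_vanish (J :|: B)%SET - log_vanish B.
Proof.
move=> IA JA; have pB := vanish_gt0 B.
have := X_markov A [ffun=> false].
rewrite -vanish_restr_cst -/B.
have PB : (0 < P (vanish X B))%E.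
  by rewrite -(fineK (fin_num_vanish B)) lte_fin.
move=> /(_ PB [set f | forall v, val v \in I -> f v = false]
              [set f | forall v, val v \in J -> f v = false]).
rewrite -!vanish_restr // /cond_prob -!vanishU => qIJ.
rewrite /log_vanish; pose q C := fine (P (vanish X C)).
rewrite -[fine (P (vanish X (I :|: J :|: B)%SET))]/(q _).
have -> : q (I :|: J :|: B)%SET = q (I :|: B)%SET * q (J :|: B)%SET / q B.
  apply: (mulIf (invr_neq0 (lt0r_neq0 pB))).
  by rewrite qIJ mulrACA !mulrA.
by rewrite ln_div ?lnM ?posrE ?mulr_gt0 ?vanish_gt0.
Qed.
End Vanish.
Arguments log_vanish {R V d Omega P} X A.

(** For A take the vertices of D reachable inside D from some x that does not reach y. A boundary
    vertex of A lying in D would be reachable too. *)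
Lemma disconnected_split (V : finType) (e : rel V) (D : {set V}) :
  symmetric e -> ~~ connected_set e D ->
  exists2 A : {set V}, A \subset D & exists x y,
    [/\ x \in A, y \in D, y \notin A & D \subset (~: outer_boundary e A)%SET].
Proof.
move=> e_sym /forall_inPn[x xD /forall_inPn[y yD xy]].
set r := (X in connect X) in xy.
exists [set v in D | connect r x v]%SET.
  by apply/fintype.subsetP => v; rewrite inE => /andP[].
exists x, y; split; rewrite ?inE ?xD ?yD ?connect0 //.
apply/fintype.subsetP => v vD; rewrite !inE vD /=.
apply/negP => /andP[xv /exists_inP[u]]; rewrite inE => /andP[uD xu] evu.
move/negP: xv; apply; apply: connect_trans xu (connect1 _).
(* The boundary provides an edge from v to u; symmetry turns it into the last step of a path to
   v. *)
by rewrite /r /= uD vD e_sym.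
Qed.

Theorem proposition3p2 (R : realType) (V : finType) (v0 : V) (e : rel V)
    (e_sym : symmetric e) (e_irr : irreflexive e)
    (e_conn : connected_set e [set: V]%SET)
    (d : measure_display) (Omega : measurableType d) (P : probability Omega R)
    (X : V -> {RV P >-> bool})
    (X_markov : markov_property X e)
    (X_pos : forall A : {set V},
      0 < cond_prob P (vanish X A) (vanish X (outer_boundary e A)))
    (nu : {charge set (nesubset v0) -> \bar R})
    (nuE : forall I : {set V},
      nu (meeting I) = (- ln (fine (P (vanish X I))))%:E)
    (D : nesubset v0) (D_disconn : ~~ connected_set e (val D)) :
  nu [set D] = 0%E.
Proof.
(* The whole vertex set has empty boundary, so there the positivity hypothesis conditions on the
   sure event. *)
have pT : 0 < fine (P (vanish X [set: V]%SET)).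
  have := X_pos [set: V]%SET; rewrite /cond_prob -vanishU finset.setTU.
  rewrite (_ : outer_boundary e _ = finset.set0); last first.
    by apply/setP => v; rewrite !inE.
  rewrite (_ : vanish X finset.set0 = setT) ?probability_setT ?divr1 //.
  by apply/seteqP; split=> // w _ v; rewrite inE.
have [A AD [x [y [xA yD yA DB]]]] := disconnected_split _ _ _ e_sym D_disconn.
set B := outer_boundary e A in DB.
have logE (I : {set V}) : I \subset val D ->
    fine (nu (meeting (~: I)%SET)) =
    log_vanish X B - log_vanish X ((A :\: I) :|: B)%SET
      - log_vanish X ((~: (A :|: B) :\: I) :|: B)%SET.
  move=> ID; rewrite nuE /= -/(log_vanish X (~: I)%SET).
  (* Since I lies in D, which misses B, removing I leaves B intact. *)
  rewrite (_ : ~: I = (A :\: I) :|: (~: (A :|: B) :\: I) :|: B)%SET.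
    rewrite (log_vanish_markov _ _ _ _ _ _ _ X_markov pT) ?finset.subsetDl //.
    by rewrite -/B !opprD opprK addrC addrA.
  apply/setP => v; rewrite !(finset.in_setC, finset.in_setU, finset.in_setD).
  have : v \in I -> v \notin B.
    by move=> /(fintype.subsetP ID)/(fintype.subsetP DB); rewrite finset.in_setC.
  by case: (v \in I) => [/(_ isT)/negPf->|_]; case: (v \in A); case: (v \in B).
have toggle (z : V) (C I : {set V}) : z \notin C -> (C :\: (z |: I) = C :\: I)%SET.
  move=> zC; apply/setP => v; rewrite !inE.
  by have [->|] := eqVneq v z; rewrite ?(negPf zC) ?andbF.
have xD := fintype.subsetP AD x xA.
have := alternating_sum_meeting R V v0 nu D.
under eq_bigr do rewrite logE // !mulrBr.
rewrite !sumrB.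
(* The constant term falls to any vertex of D, the term in [A :\: I] to y outside A, and the last
   term to x in A. *)
rewrite (alternating_sum_toggle _ _ _ x) //.
rewrite (alternating_sum_toggle _ _ _ y) //; last first.
  by move=> I _; rewrite toggle.
rewrite (alternating_sum_toggle _ _ _ x) //; last first.
  by move=> I _; rewrite toggle // !inE xA.
rewrite !subr0 => /esym/eqP; rewrite mulf_eq0 oppr_eq0 signr_eq0 /= => /eqP nuD.
(* Finiteness matters here: [fine] also sends infinite values to 0. *)
by rewrite -(fineK (charge_fin_num R V v0 nu [set D])) nuD.
Qed.
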